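(* Let $Z$ be a continuous random variable with density $f$, CDF $F$, finite expectation, and support unbounded on the right. Let $\alpha\in[0,1)$ and suppose $h_\alpha(z)\le C$ for all $z\in\mathbb{R}$. Run GBPA with the stochastically smoothed potential $\tilde\Phi$ with perturbation $Z$. Then for every gain sequence $g_1,\dots,g_T\in[-1,0]^N$ and every round $t$, $$\mathbb{E}\big[D_{\tilde\Phi}(\hat G_t,\hat G_{t-1}) \,\big|\, i_1,\dots,i_{t-1}\big] \le \frac{2C}{1-\alpha}\, N.$$
   Context: Generalized hazard rate: for $\alpha\in[0,1)$, $h_\alpha(z) = \frac{f(z)|z|^\alpha}{(1-F(z))^{1-\alpha}}$. Adversarial multi-armed bandit: $N$ arms, $T$ rounds; an oblivious adversary fixes $g_1,\dots,g_T \in [-1,0]^N$ in advance. The stochastically smoothed potential is $\tilde\Phi(G) = \mathbb{E}[\max_{i}(G_i + Z_i)]$ for $G\in\mathbb{R}^N$, $Z_1,\dots,Z_N$ i.i.d. copies of $Z$; $\nabla_i\tilde\Phi(G) = \mathbb{P}(i = \arg\max_j (G_j+Z_j))$. GBPA$(\tilde\Phi)$: $\hat G_0 = 0$; for $t=1,\dots,T$: $p_t = \nabla\tilde\Phi(\hat G_{t-1})$, draw $i_t \sim p_t$, observe only $g_{t,i_t}$, set $\hat g_t = \frac{g_{t,i_t}}{p_{t,i_t}} e_{i_t}$, $\hat G_t = \hat G_{t-1} + \hat g_t$. Bregman divergence: $D_{\tilde\Phi}(x,y) = \tilde\Phi(x)-\tilde\Phi(y)-\langle\nabla\tilde\Phi(y),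 x-y\rangle$. *)

(* Defs.v *)
From HB Require Import structures.
From mathcomp Require Import all_boot all_order all_algebra.
From mathcomp Require Import all_classical all_reals all_analysis.
Set Implicit Arguments. Unset Strict Implicit. Unset Printing Implicit Defensive.
Import Order.TTheory GRing.Theory Num.Theory.
Import numFieldNormedType.Exports.
Local Open Scope classical_set_scope.
Local Open Scope ring_scope.

Section Defs.
Context {R : realType} {d : measure_display} {T : measurableType d}.

Definition mutually_independent (P : probability T R) (N : nat)
  (Z : 'I_N -> {RV P >-> R}) : Prop :=
  forall B : 'I_N -> set R, (forall i, measurable (B i)) ->
    P (\bigcap_(i in setT) (Z i @^-1` B i)) = (\prod_(i < N) P (Z i @^-1` B i))%E.

Definition has_density (P : probability T R) (X : {RV P >-> R}) (f : R -> R) : Prop :=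
  [/\ measurable_fun setT f, (forall x, 0 <= f x) &
      forall A : set R, measurable A ->
        P (X @^-1` A) = (\int[lebesgue_measure]_(x in A) (f x)%:E)%E].

Definition dens_cdf (f : R -> R) (z : R) : R :=
  fine (\int[lebesgue_measure]_(x in `]-oo, z]) (f x)%:E)%E.

Definition gen_hazard (f : R -> R) (alpha z : R) : R :=
  f z * (`|z| `^ alpha) / ((1 - dens_cdf f z) `^ (1 - alpha)).

Definition smoothPhi (P : probability T R) (N : nat) (Z : 'I_N -> {RV P >-> R})
  (G : 'I_N -> R) : \bar R :=
  (\int[P]_w (\big[Order.max/-oo]_(i < N) (G i + Z i w)%:E))%E.

(* gradient of smoothPhi~ : grad_i smoothPhi~(G) = P(i = argmax_j (G_j + Z_j)).
   (Ties have probability 0 since Z has a density; we use the strict argmax.) *)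
Definition grad_smoothPhi (P : probability T R) (N : nat) (Z : 'I_N -> {RV P >-> R})
  (G : 'I_N -> R) (i : 'I_N) : R :=
  fine (P [set w | forall j, j != i -> G j + Z j w < G i + Z i w]).

Definition bregman_smoothPhi (P : probability T R) (N : nat) (Z : 'I_N -> {RV P >-> R})
  (x y : 'I_N -> R) : \bar R :=
  (smoothPhi Z x - smoothPhi Z y - (\sum_(i < N) grad_smoothPhi Z y i * (x i - y i))%:E)%E.

Definition add_est (N : nat) (G : 'I_N -> R) (i : 'I_N) (c : R) : 'I_N -> R :=
  fun j => G j + (if j == i then c else 0).

(* GBPA state \hat G_s, given gains g (g t = gain vector of round t, t >= 1)
   and the arms drawn  arm 1, arm 2, ... : \hat G_0 = 0,
   \hat G_{s+1} = \hat G_s + g_{s+1,i_{s+1}} / p_{s+1,i_{s+1}} e_{i_{s+1}},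
   with p_{s+1} = grad smoothPhi~(\hat G_s). *)
Fixpoint gbpa_Ghat (P : probability T R) (N : nat) (Z : 'I_N -> {RV P >-> R})
  (g : nat -> 'I_N -> R) (arm : nat -> 'I_N) (s : nat) : 'I_N -> R :=
  match s with
  | 0 => fun _ => 0
  | s'.+1 =>
      let G := gbpa_Ghat Z g arm s' in
      let i := arm s'.+1 in
      add_est G i (g s'.+1 i / grad_smoothPhi Z G i)
  end.

End Defs.

(* Main.v *)
Require Import Defs.
From HB Require Import structures.
From mathcomp Require Import all_boot all_order all_algebra.
From mathcomp Require Import all_classical all_reals all_analysis.
From mathcomp Require Import measurable_realfun ring lra.
Import Order.TTheory GRing.Theory Num.Theory.
Import numFieldNormedType.Exports.
Local Open Scope classical_set_scope.
Local Open Scope ring_scope.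

(** Fix an arm [i], put [b = 1 - alpha] and [p = grad_i], and let [V] be the
    largest score of the other arms minus [G_i].  Lowering the score of [i] by
    [s <= 1 / p] changes the potential to first order except on the event
    [V < Z_i < V + s], so the divergence is at most [s * P(V < Z_i < V + s)].
    Given [V = v], the hazard bound [f z <= C (1 - F v)^b |z|^-alpha] for
    [z > v] and the integrability of [|z|^-alpha] bound the conditional
    probability by [(2 C / b) s^b (1 - F v)^b].  As [V] is independent of [Z_i],
    the mean of [1 - F V] is [p], and Jensen gives [(2 C / b) s^b p^b].  Hence
    [p] times the divergence is at most [(2 C / b) (s p)^(1 + b) <= 2 C / b]. *)

(** * Integrals dominated by a power singularity *)

(** The offset 3 keeps every margin below half the length, so each compact interval of the
    exhaustion is nondegenerate. *)
Lemma itv_oo_bigcup_itv_cc {R : realType} (a b : R) : a < b ->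
  `]a, b[%classic =
  \bigcup_n `[a + (b - a) / n.+3%:R, b - (b - a) / n.+3%:R]%classic.
Proof.
move=> ab; apply/seteqP; split => x /=; last first.
  move=> [n _ /=]; rewrite !in_itv/= => /andP[h1 h2].
  have e0 : 0 < (b - a) / n.+3%:R by rewrite divr_gt0 ?subr_gt0.
  by rewrite (lt_le_trans _ h1) ?ltrDl// (le_lt_trans h2)// gtrBl.
rewrite in_itv/= => /andP[ax xb].
have m0 : 0 < Num.min (x - a) (b - x) by rewrite lt_min !subr_gt0 ax xb.
pose q := (b - a) / Num.min (x - a) (b - x).
have q0 : 0 <= q by rewrite divr_ge0 ?subr_ge0 ?ltW.
exists (Num.truncn q) => //=.
have qn : q < (Num.truncn q).+3%:R.
  by rewrite (lt_trans (truncnS_gt _))// ltr_nat.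
have n0 : 0 < (Num.truncn q).+3%:R :> R by [].
have : (b - a) / (Num.truncn q).+3%:R < Num.min (x - a) (b - x).
  by rewrite ltr_pdivrMr// mulrC -ltr_pdivrMr.
rewrite lt_min in_itv/=; move: (_ / _.+3%:R) => e /andP[? ?].
by apply/andP; split; lra.
Qed.

(** The fundamental theorem of calculus applies on compact subintervals, and monotone convergence
    carries the uniform bound on the increments of [H] to the open interval. Thus [h] may blow up at
    an endpoint. *)
Lemma ge0_integral_itv_oo_le {R : realType} (h H : R -> R) (a b M : R) :
  a < b ->
  {in `]a, b[, forall x, 0 <= h x} ->
  {in `]a, b[, continuous h} ->
  {in `]a, b[, forall x : R, is_derive x 1 H (h x)} ->
  {in `]a, b[ &, forall x y, H y - H x <= M} ->
  (\int[lebesgue_measure]_(x in `]a, b[) (h x)%:E <= M%:E)%E.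
Proof.
move=> ab h0 ch dH HM.
pose F n := `[a + (b - a) / n.+3%:R, b - (b - a) / n.+3%:R]%classic.
have ba0 : 0 < b - a by rewrite subr_gt0.
have Fsub n : F n `<=` `]a, b[%classic.
  by rewrite itv_oo_bigcup_itv_cc//; exact: bigcup_sup.
have mh : measurable_fun `]a, b[%classic h.
  by apply: open_continuous_measurable_fun => // x; rewrite inE; exact: ch.
have mE n : measurable_fun (F n) (EFin \o h).
  apply/measurable_EFinP; apply: measurable_funS mh => //; exact: Fsub.
have ndF : nondecreasing_seq F.
  move=> m n mn; apply/subsetPset => x; rewrite /F/= !in_itv/= => /andP[h1 h2].
  have : (b - a) / n.+3%:R <= (b - a) / m.+3%:R.
    by rewrite ler_pM2l// lef_pV2 ?posrE// ler_nat.
  move: h1 h2; move: (_ / n.+3%:R) (_ / m.+3%:R) => u v *.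
  by apply/andP; split; lra.
have h0F n x : F n x -> (0 <= (EFin \o h) x)%E.
  by move=> Fx; rewrite lee_fin; apply: h0; exact: Fsub Fx.
have mF n : measurable (F n) by exact: measurable_itv.
have := @ge0_nondecreasing_set_cvg_integral _ (measurableTypeR R) R F (EFin \o h)
  lebesgue_measure ndF mF mE h0F.
rewrite -itv_oo_bigcup_itv_cc// => cv.
rewrite -(cvg_lim _ cv)//.
apply: lime_le; first by apply/cvg_ex; eexists; exact: cv.
apply: nearW => n; rewrite /F.
have n3 : (b - a) / n.+3%:R < (b - a) / 2.
  by rewrite ltr_pM2l// ltf_pV2 ?posrE// ltr_nat.
have n0 : 0 < (b - a) / n.+3%:R by rewrite divr_gt0.
move: n3 n0; move: (_ / n.+3%:R) => e n3 n0.
set x := a + e; set y := b - e.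
have xy : x < y by rewrite /x /y; lra.
have xyab z : x <= z <= y -> z \in `]a, b[.
  rewrite /x /y in_itv/= => /andP[? ?]; apply/andP; split; lra.
have dHz z : x <= z <= y -> derivable H z 1.
  by move=> /xyab/dH[].
rewrite (continuous_FTC2 (F := H))//.
- by rewrite -EFinB lee_fin; apply: HM; apply: xyab; rewrite lexx ltW.
- apply: continuous_in_subspaceT => z; rewrite inE/= in_itv/= => /xyab.
  exact: ch.
- have : {within `[x, y], continuous H}.
    apply: derivable_within_continuous => z; rewrite in_itv/=; exact: dHz.
  move/(continuous_within_itvP _ xy) => [_ ? ?].
  split => // z; rewrite in_itv/= => /andP[? ?]; apply: dHz.
  by rewrite !ltW.
- move=> z; rewrite in_itv/= => /andP[? ?].
  have /dH[] : z \in `]a, b[ by apply: xyab; rewrite !ltW.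
  by rewrite derive1E.
Qed.

Lemma is_derive_powR_shift {R : realType} (k p c x : R) : c < x ->
  is_derive x 1 (fun z => k * (z - c) `^ p) (k * (p * (x - c) `^ (p - 1))).
Proof.
move=> cx.
have d0 : is_derive x 1 (fun z : R => z - c) 1.
  by apply: is_derive_eq; rewrite subr0.
have d1 : is_derive (x - c) 1 (@powR R ^~ p) (p * (x - c) `^ (p - 1)).
  by apply: is_derive1_powR; rewrite subr_gt0.
have d2 := @is_derive1_comp _ (@powR R ^~ p) (fun z : R => z - c) x _ _ d1 d0.
by have := @is_deriveZ _ _ _ _ k _ _ _ d2; rewrite /GRing.scale/= mulr1.
Qed.

Lemma is_derive_powR_reflect {R : realType} (k p c x : R) : x < c ->
  is_derive x 1 (fun z => k * (c - z) `^ p) (- (k * (p * (c - x) `^ (p - 1)))).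
Proof.
move=> cx.
have d0 : is_derive x 1 (fun z : R => c - z) (-1).
  by apply: is_derive_eq; rewrite add0r mul1r.
have d1 : is_derive (c - x) 1 (@powR R ^~ p) (p * (c - x) `^ (p - 1)).
  by apply: is_derive1_powR; rewrite subr_gt0.
have d2 := @is_derive1_comp _ (@powR R ^~ p) (fun z : R => c - z) x _ _ d1 d0.
by have := @is_deriveZ _ _ _ _ k _ _ _ d2; rewrite /GRing.scale/= mulrN1 mulrN.
Qed.

Lemma is_derive_continuous {R : realType} (h : R -> R) (x l : R) :
  is_derive x 1 h l -> {for x, continuous h}.
Proof.
by move=> [dh _]; apply: differentiable_continuous; exact/derivable1_diffP.
Qed.

Lemma ger0_powRN_le {R : realType} (p x y : R) : 0 <= p -> 0 < x -> x <= y ->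
  y `^ (- p) <= x `^ (- p).
Proof.
move=> p0 x0 xy; rewrite !powRN lef_pV2 ?posrE ?powR_gt0 ?(lt_le_trans x0)//.
by rewrite ge0_ler_powR ?nnegrE ?(ltW x0) ?(ltW (lt_le_trans x0 xy)).
Qed.

Section integral_le_powR.
Context {R : realType}.
Variables (alpha K : R) (f : R -> R).
Hypotheses (alpha01 : 0 <= alpha < 1) (K0 : 0 <= K).
Hypotheses (mf : measurable_fun setT f) (f0 : forall x, 0 <= f x).

Let be := 1 - alpha.
Let be0 : 0 < be. Proof. by have [_ a1] := andP alpha01; rewrite subr_gt0. Qed.
Let beE : be - 1 = - alpha. Proof. by rewrite /be; ring. Qed.

Lemma integral_itv_oo_le_powRl (a b : R) : a < b ->
  (forall z, a < z < b -> f z <= K * (z - a) `^ (- alpha)) ->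
  (\int[lebesgue_measure]_(x in `]a, b[) (f x)%:E <=
    (K / be * (b - a) `^ be)%:E)%E.
Proof.
move=> ab fK.
have le_itv x : x \in `]a, b[ -> a < x < b by rewrite in_itv.
apply: (@le_trans _ _ (\int[lebesgue_measure]_(x in `]a, b[)
    (K * (x - a) `^ (- alpha))%:E)%E).
  apply: ge0_le_integral => //=.
  - by move=> x _; rewrite lee_fin.
  - by apply/measurable_EFinP; exact: measurable_funTS.
  - apply/measurable_EFinP; apply: measurable_funM => //.
    apply: (@measurableT_comp _ _ _ _ _ _ (@powR R ^~ (- alpha))) => //.
    exact: measurable_funB.
(* Since [be > 0], the antiderivative stays bounded at the singular endpoint [a]; being nonnegative
   and increasing, it has increments at most its value at [b]. *)
apply: (@ge0_integral_itv_oo_le _ _ (fun x => K / be * (x - a) `^ be)) => //.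
- by move=> x _; rewrite mulr_ge0// powR_ge0.
- move=> x /le_itv/andP[ax _].
  by apply: is_derive_continuous; exact: is_derive_powR_shift.
- move=> x /le_itv/andP[ax _].
  have := @is_derive_powR_shift _ (K / be) be a x ax.
  by rewrite mulrA divfK ?gt_eqF// beE.
- move=> x y /le_itv/andP[ax _] /le_itv/andP[ay yb].
  rewrite (@le_trans _ _ (K / be * (y - a) `^ be))//.
    by rewrite gerBl mulr_ge0 ?powR_ge0// divr_ge0// ltW.
  rewrite ler_wpM2l ?divr_ge0 ?(ltW be0)// ge0_ler_powR ?nnegrE ?(ltW be0)//; lra.
Qed.

Lemma integral_itv_oo_le_powRr (a b : R) : a < b ->
  (forall z, a < z < b -> f z <= K * (b - z) `^ (- alpha)) ->
  (\int[lebesgue_measure]_(x in `]a, b[) (f x)%:E <=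
    (K / be * (b - a) `^ be)%:E)%E.
Proof.
move=> ab fK.
have le_itv x : x \in `]a, b[ -> a < x < b by rewrite in_itv.
apply: (@le_trans _ _ (\int[lebesgue_measure]_(x in `]a, b[)
    (K * (b - x) `^ (- alpha))%:E)%E).
  apply: ge0_le_integral => //=.
  - by move=> x _; rewrite lee_fin.
  - by apply/measurable_EFinP; exact: measurable_funTS.
  - apply/measurable_EFinP; apply: measurable_funM => //.
    apply: (@measurableT_comp _ _ _ _ _ _ (@powR R ^~ (- alpha))) => //.
    exact: measurable_funB.
apply: (@ge0_integral_itv_oo_le _ _ (fun x => - (K / be) * (b - x) `^ be)) => //.
- by move=> x _; rewrite mulr_ge0// powR_ge0.
- move=> x /le_itv/andP[_ xb].
  by apply: is_derive_continuous; exact: is_derive_powR_reflect.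
- move=> x /le_itv/andP[_ xb].
  have := @is_derive_powR_reflect _ (- (K / be)) be b x xb.
  by rewrite mulNr opprK mulrA divfK ?gt_eqF// beE.
- move=> x y /le_itv/andP[ax xb] /le_itv/andP[_ yb].
  rewrite !mulNr opprK addrC.
  rewrite (@le_trans _ _ (K / be * (b - x) `^ be))//.
    by rewrite gerBl mulr_ge0 ?powR_ge0// divr_ge0// ltW.
  rewrite ler_wpM2l ?divr_ge0 ?(ltW be0)// ge0_ler_powR ?nnegrE ?(ltW be0)//; lra.
Qed.

(* Away from [0] the singularity may be moved to the endpoint nearest to [0],
   which only increases the majorant; hence the splitting of the interval at
   [0] and the factor [2]. *)
Lemma integral_itv_oo_le_abs_powR (v s : R) : 0 < s ->
  (forall z, v < z < v + s -> z != 0 -> f z <= K * `|z| `^ (- alpha)) ->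
  (\int[lebesgue_measure]_(x in `]v, (v + s)%R[) (f x)%:E <=
    (2 * (K / be * s `^ be))%:E)%E.
Proof.
move=> s0 fK.
have Kbe : 0 <= K / be by rewrite divr_ge0// ltW.
have mono u : 0 <= u -> u <= s -> K / be * u `^ be <= K / be * s `^ be.
  move=> u0 us; rewrite ler_wpM2l// ge0_ler_powR ?nnegrE ?(ltW be0) ?(ltW s0)//.
have [a0 a1] := andP alpha01.
have pos a b : v <= a -> b <= v + s -> 0 <= a -> a < b ->
    (\int[lebesgue_measure]_(x in `]a, b[) (f x)%:E <=
      (K / be * s `^ be)%:E)%E.
  move=> va bs a_ge0 ab; apply: (@le_trans _ _ (K / be * (b - a) `^ be)%:E).
    apply: integral_itv_oo_le_powRl => // z /andP[az zb].
    have z0 : 0 < z by lra.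
    apply: le_trans (fK z _ _) _; [lra|by rewrite gt_eqF|].
    by rewrite gtr0_norm// ler_wpM2l// ger0_powRN_le//; lra.
  by rewrite lee_fin; apply: mono; lra.
have neg a b : v <= a -> b <= v + s -> b <= 0 -> a < b ->
    (\int[lebesgue_measure]_(x in `]a, b[) (f x)%:E <=
      (K / be * s `^ be)%:E)%E.
  move=> va bs b_le0 ab; apply: (@le_trans _ _ (K / be * (b - a) `^ be)%:E).
    apply: integral_itv_oo_le_powRr => // z /andP[az zb].
    have z0 : z < 0 by lra.
    apply: le_trans (fK z _ _) _; [lra|by rewrite lt_eqF|].
    by rewrite ltr0_norm// ler_wpM2l// ger0_powRN_le//; lra.
  by rewrite lee_fin; apply: mono; lra.
have two : ((K / be * s `^ be)%:E <= (2 * (K / be * s `^ be))%:E)%E.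
  by rewrite lee_fin ler_peMl// ?ler1n// mulr_ge0// powR_ge0.
have [v0|v0] := leP 0 v.
  by apply: le_trans two; apply: pos => //; lra.
have [vs0|vs0] := leP (v + s) 0.
  by apply: le_trans two; apply: neg => //; lra.
have -> : `]v, (v + s)[%classic = `]v, 0[ `|` `[0, (v + s)[ :> set R.
  apply/seteqP; split => x /=; rewrite !in_itv/=.
    by have [?|?] := ltP x 0; move=> /andP[? ?]; [left|right]; apply/andP.
  by move=> [|] /andP[? ?]; apply/andP; split; lra.
have mE : measurable_fun [set: R] (EFin \o f) by exact/measurable_EFinP.
rewrite ge0_integral_setU//=; [|exact: measurable_funTS| |].
- rewrite mulr_natl mulr2n EFinD leeD//.
    by apply: neg => //; lra.
  (* The null point 0 is dropped: [powR] sends base 0 with a nonzero exponent to 0, so the majorant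
     may fail there. *)
  rewrite -integral_itv_obnd_cbnd; last exact: measurable_funTS.
  by apply: pos => //; lra.
- by move=> x _; rewrite lee_fin.
- apply/disj_setPS => x [] /=; rewrite !in_itv/= => /andP[_ ?] /andP[? _]; lra.
Qed.

End integral_le_powR.

(** * Independent pairs *)

(** Open left rays are stable under intersection and generate the Borel sets. This reduces
    independence from [X] to events [X < a], the natural ones when [X] is a maximum. *)
Lemma measure_unique_rays {R : realType}
    (m1 m2 : {measure set R -> \bar R}) :
  (m1 setT < +oo)%E ->
  (forall a, m1 `]-oo, a[%classic = m2 `]-oo, a[%classic) ->
  forall A, measurable A -> m1 A = m2 A.
Proof.
move=> m1oo m12 A mA.
apply: (@measure_unique _ R _ (@RGenInftyO.G R)
  (fun n => `]-oo, n%:R[%classic) _ _ _ _ m1 m2) => //.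
- exact: RGenInftyO.measurableE.
- move=> _ _ [x ->] [y ->]; exists (Num.min x y).
  by apply/seteqP; split => z /=; rewrite !in_itv/= lt_min => /andP.
- by move=> i; exists i%:R.
- rewrite -subTset => x _ /=; exists (Num.truncn `|x|).+1 => //=.
  by rewrite in_itv/= (le_lt_trans (ler_norm x))// truncnS_gt.
- by move=> _ [x ->].
- move=> k; apply: le_lt_trans m1oo; apply: le_measure; rewrite ?inE//.
Qed.

(** For fixed [B], both sides of the factorization are finite measures in the set for [X] and agree
    on rays, hence everywhere. This settles measurable rectangles, which determine the product
    measure. *)
Lemma joint_law_product {R : realType} {d : measure_display}
    {T : measurableType d} (P : probability T R) (X Y : {mfun T >-> R}) :
  (forall a B, measurable B ->
    P (X @^-1` `]-oo, a[ `&` Y @^-1` B) =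
    (P (X @^-1` `]-oo, a[) * P (Y @^-1` B))%E) ->
  forall E : set (R * R), measurable E ->
    P [set w | E (X w, Y w)] =
    (distribution P X \x distribution P Y)%E E.
Proof.
move=> indep.
have mX : measurable_fun setT X by [].
have mY : measurable_fun setT Y by [].
have mpre (Z : {mfun T >-> R}) B : measurable B -> measurable (Z @^-1` B).
  by move=> mB; rewrite -[_ @^-1` _]setTI; exact: measurable_funP.
have indepAB A B : measurable A -> measurable B ->
    P (X @^-1` A `&` Y @^-1` B) = (P (X @^-1` A) * P (Y @^-1` B))%E.
  move=> mA mB; rewrite muleC.
  have PB0 : 0 <= fine (P (Y @^-1` B)) by exact: fine_ge0.
  have mYB := mpre Y B mB.
  have PBE : ((fine (P (Y @^-1` B)))%:E = P (Y @^-1` B))%E.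
    by rewrite fineK// fin_num_measure.
  have := @measure_unique_rays R (pushforward (mrestr P mYB) X)
    (mscale (NngNum PB0) (distribution P X)) _ _ A mA.
  rewrite /= /pushforward /mrestr /mscale/= /distribution /pushforward/= PBE.
  apply => [//||a].
    rewrite preimage_setT setTI.
    by rewrite (le_lt_trans (probability_le1 _ _)) ?ltry.
  by rewrite indep// muleC.
have mXY : measurable_fun setT (fun w => (X w, Y w)) by exact: measurable_fun_pair.
pose XY : {mfun T >-> (R * R)%type} :=
  HB.pack (fun w => (X w, Y w)) (isMeasurableFun.Build _ _ _ _ _ mXY).
move=> E mE; symmetry.
rewrite (@product_measure_unique _ _ _ _ R (distribution P X) (distribution P Y)
  (distribution P XY))//.
Qed.

(** The right side is the tangent at [m] of a concave power. Integrated against a law of mean [m],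
    it yields Jensen's inequality. *)
Lemma powR_le_tangent {R : realType} (be m x : R) :
  0 < be <= 1 -> 0 < m -> 0 <= x ->
  x `^ be <= m `^ be * (be / m * x + (1 - be)).
Proof.
move=> /andP[be0 be1] m0 x0.
have bernoulli e : 0 <= e -> e `^ be <= be * e + (1 - be).
  move=> e0; have [->|be1'] := eqVneq be 1.
    by rewrite powRr1// subrr addr0 mul1r.
  have be1'' : 0 < 1 - be by rewrite subr_gt0 lt_neqAle be1' be1.
  (* Bernoulli's inequality is Young's inequality for the [be]-th power of [e] and 1, with conjugate
     exponents [1 / be] and [1 / (1 - be)]; the second degenerates at [be = 1], treated above. *)
  have := @conjugate_powR R (e `^ be) 1 be^-1 (1 - be)^-1.
  rewrite powR_ge0 !invr_gt0 !invrK be0 be1'' -powRrM mulfV ?gt_eqF//.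
  rewrite powRr1// powR1 mulr1 mul1r (mulrC e); apply => //; ring.
have -> : x = m * (x / m) by rewrite mulrC divfK ?gt_eqF.
have xm0 : 0 <= x / m by rewrite divr_ge0// ltW.
rewrite powRM ?(ltW m0)// ler_wpM2l ?powR_ge0//.
by rewrite mulrA divfK ?gt_eqF//; exact: bernoulli.
Qed.

Lemma measurable_set_ltr {R : realType} {d : measure_display}
    {T : measurableType d} (f g : T -> R) :
  measurable_fun setT f -> measurable_fun setT g ->
  measurable [set x | f x < g x].
Proof.
move=> mf mg.
rewrite (_ : mkset _ = setT `&` (g \- f) @^-1` `]0, +oo[%classic).
  by apply: measurable_funB => //; exact: measurable_itv.
by rewrite setTI; apply/seteqP; split => x /=; rewrite in_itv/= andbT subr_gt0.
Qed.

(** Fubini conditions on [X = v], where [slab] bounds the section by a concave function of the tail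
    [q v]. The mean of [q] is [p], so Jensen replaces [q] by [p]. *)
Lemma product_slab_le {R : realType} {d : measure_display}
    {T : measurableType d} (P : probability T R) (X Y : {mfun T >-> R})
    (K be s : R) :
  (forall E : set (R * R), measurable E ->
    P [set w | E (X w, Y w)] =
    (distribution P X \x distribution P Y)%E E) ->
  0 <= K -> 0 < be <= 1 ->
  (forall v, (P (Y @^-1` `]v, (v + s)%R[) <=
     (K * fine (P (Y @^-1` `]v, +oo[)) `^ be)%:E)%E) ->
  0 < fine (P [set w | X w < Y w]) ->
  (P [set w | X w < Y w < X w + s]%R <=
    (K * fine (P [set w | X w < Y w]%R) `^ be)%:E)%E.
Proof.
move=> law K0 be01 slab p0.
pose E1 : set (R * R) := [set xy | xy.1 < xy.2].
pose E2 : set (R * R) := E1 `&` [set xy | xy.2 < xy.1 + s].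
have mE1 : measurable E1 by exact: measurable_set_ltr.
have mE2 : measurable E2.
  apply: measurableI => //; apply: measurable_set_ltr => //.
  exact: measurable_funD.
set p := fine _ in p0 *.
pose q v := fine (P (Y @^-1` `]v, +oo[)).
have mpre B : measurable B -> measurable (Y @^-1` B).
  by move=> mB; rewrite -[_ @^-1` _]setTI; exact: measurable_funP.
have qE v : distribution P Y (xsection E1 v) = (q v)%:E.
  rewrite /q fineK; last by rewrite fin_num_measure//; exact: mpre.
  rewrite /distribution /pushforward; congr (P _).
  by apply/seteqP; split => w; rewrite /xsection/= inE/= in_itv/= andbT.
have q0 v : 0 <= q v by exact: fine_ge0.
have mq : measurable_fun setT (EFin \o q).
  rewrite (_ : _ \o _ = distribution P Y \o xsection E1).
    exact: measurable_fun_xsection.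
  by apply/funext => v /=; rewrite qE.
have pE : (\int[distribution P X]_v (q v)%:E = p%:E)%E.
  under eq_integral do rewrite -qE.
  rewrite -[LHS]/((distribution P X \x distribution P Y)%E E1) -law//.
  rewrite /p fineK// fin_num_measure//.
  exact: measurable_set_ltr.
have [be0 be1] := andP be01.
have c0 : 0 <= K * (p `^ be) by rewrite mulr_ge0// powR_ge0.
(* The integrand is [K] times the tangent at [p], affine in [q v]; its integral is [K] times the
   [be]-th power of [p], because the weights [be] and [1 - be] add up to 1. *)
apply: (@le_trans _ _ (\int[distribution P X]_v
    ((K * (p `^ be) * (be / p))%:E * (q v)%:E + (K * (p `^ be) * (1 - be))%:E)))%E.
  rewrite (_ : [set w | _] = [set w | E2 (X w, Y w)]); last first.
    by apply/seteqP; split => w /=; rewrite /E2/= => /andP.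
  rewrite law//; apply: ge0_le_integral => //=.
  - exact: measurable_fun_xsection.
  - by apply: emeasurable_funD => //; exact: emeasurable_funM.
  - move=> v _; apply: (@le_trans _ _ (K * q v `^ be)%:E).
      apply: le_trans (slab v); rewrite le_eqVlt; apply/orP; left; apply/eqP.
      rewrite /distribution /pushforward; congr (P _).
      apply/seteqP; split => w; rewrite /xsection/= inE/= in_itv/=.
        by move=> [-> ->].
      by move=> /andP.
    rewrite -EFinM -EFinD lee_fin.
    rewrite -[_ * (be / p)]mulrA -[_ * (1 - be)]mulrA -[_ * (_ * _) * _]mulrA.
    rewrite -mulrDr ler_wpM2l// -[_ * (be / p) * _]mulrA -mulrDr.
    exact: powR_le_tangent.
rewrite ge0_integralD//=; last 3 first.
- by move=> v _; rewrite lee_fin mulr_ge0// mulr_ge0// divr_ge0// ltW.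
- exact: emeasurable_funM.
- by move=> v _; rewrite lee_fin mulr_ge0// subr_ge0.
rewrite ge0_integralZl//=; last 2 first.
- by move=> v _; rewrite lee_fin.
- by rewrite lee_fin mulr_ge0// divr_ge0// ltW.
rewrite integral_cst// pE [X in (_ + _ * X)%E]probability_setT mule1 -EFinM -EFinD.
rewrite lee_fin le_eqVlt; apply/orP; left; apply/eqP.
by rewrite -[_ * p]mulrA divfK ?gt_eqF// -mulrDr addrC subrK mulr1.
Qed.

(** * Bregman divergence of the smoothed potential *)

Lemma measurable_bigmaxr {R : realType} {d : measure_display}
    {T : measurableType d} (I : Type) (r : seq I) (Q : pred I)
    (F0 : T -> R) (F : I -> T -> R) :
  measurable_fun setT F0 -> (forall i, measurable_fun setT (F i)) ->
  measurable_fun setT (fun w => \big[Num.max/F0 w]_(i <- r | Q i) F i w).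
Proof.
move=> mF0 mF; elim: r => [|i r IH].
  by under eq_fun do rewrite big_nil.
under eq_fun do rewrite big_cons.
by case: (Q i) => //; exact: measurable_maxr.
Qed.

(** Seeding with one of its own terms does not change a maximum, and it replaces the neutral element
    [-oo] by a real number, which real-valued integration needs. *)
Lemma bigmaxe_EFin {R : realType} (I : finType) (i0 : I) (F : I -> R) :
  (\big[Order.max/-oo]_i (F i)%:E)%E = (\big[Num.max/F i0]_i F i)%:E.
Proof.
apply/eqP; rewrite eq_le; apply/andP; split.
  apply/bigmax_leP; split; first exact: leNye.
  by move=> i _; rewrite lee_fin le_bigmax.
have leF i : ((F i)%:E <= \big[Order.max/-oo]_i (F i)%:E)%E.
  exact: (le_bigmax _ (fun i => (F i)%:E)).
elim/big_ind: (X in (X%:E <= _)%E) => // x y; rewrite /Num.max; case: ifP => //.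
Qed.

Section bregman_bound.
Context {R : realType} {d : measure_display} {T : measurableType d}.
Variables (P : probability T R) (N : nat) (Z : 'I_N -> {RV P >-> R}).
Hypothesis intZ : forall i, P.-integrable setT (EFin \o Z i).

Let mZ i : measurable_fun setT (Z i). Proof. by []. Qed.

Let mGZ (G : 'I_N -> R) i : measurable_fun setT (fun w => G i + Z i w).
Proof. exact: measurable_funD. Qed.

Let maxGZ (i : 'I_N) (G : 'I_N -> R) (w : T) : R :=
  \big[Num.max/G i + Z i w]_j (G j + Z j w).

Let maxGZ_ge i G w j : G j + Z j w <= maxGZ i G w.
Proof. exact: (le_bigmax _ (fun j => G j + Z j w)). Qed.

Let maxGZ_le i G w x : (forall j, G j + Z j w <= x) -> maxGZ i G w <= x.
Proof. by move=> h; apply/bigmax_leP; split. Qed.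

(** The maximum lies above its own term [i] and below some single term, so the sum of all absolute
    scores dominates it. *)
Let integrable_maxGZ i G : P.-integrable setT (EFin \o maxGZ i G).
Proof.
apply: (@le_integrable _ _ _ _ _ measurableT _
    (fun w => \sum_j (`|(G j)%:E + (Z j w)%:E|)%E)).
- by apply/measurable_EFinP; exact: measurable_bigmaxr.
- move=> w _ /=.
  have -> : \sum_j (`|(G j)%:E + (Z j w)%:E|)%E = (\sum_j `|G j + Z j w|)%:E.
    by rewrite -sumEFin; apply: eq_bigr.
  rewrite lee_fin [leRHS]ger0_norm; last by apply: sumr_ge0.
  have le_sum j : `|G j + Z j w| <= \sum_j `|G j + Z j w|.
    by rewrite (bigD1 j)//= lerDl sumr_ge0.
  rewrite ler_norml; apply/andP; split.
    rewrite (le_trans _ (maxGZ_ge i G w i))// lerNl.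
    by rewrite (le_trans _ (le_sum i))// -normrN ler_norm.
  apply: maxGZ_le => j; exact: le_trans (ler_norm _) (le_sum j).
- apply: integrable_sum => //= j _.
  have : P.-integrable setT (fun w => (G j)%:E + (Z j w)%:E)%E.
    apply: integrableD => //; last exact: intZ.
    exact: finite_measure_integrable_cst.
  exact: integrable_abse.
Qed.

Let smoothPhiE i G : smoothPhi Z G = (\int[P]_w (maxGZ i G w)%:E)%E.
Proof. by apply: eq_integral => w _; rewrite (bigmaxe_EFin _ i). Qed.

Let fin_smoothPhi i G : (\int[P]_w (maxGZ i G w)%:E \is a fin_num)%E.
Proof. exact: integrable_fin_num (integrable_maxGZ i G). Qed.

Lemma measurable_argmax (G : 'I_N -> R) (i : 'I_N) :
  measurable [set w | forall j, j != i -> G j + Z j w < G i + Z i w].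
Proof.
rewrite (_ : mkset _ = \bigcap_(j in [set j | j != i])
    [set w | G j + Z j w < G i + Z i w]).
  apply: fin_bigcap_measurable => [|j _]; first exact: finite_finset.
  exact: measurable_set_ltr.
by apply/seteqP; split => w h j; exact: h.
Qed.

(* Lowering the score of arm [i] by [s] lowers the maximum by at most [s], and
   by exactly [s] where [i] stays optimal; only the event [S], where [i] loses
   its lead, contributes to the divergence. *)
Lemma bregman_smoothPhi_le (G : 'I_N -> R) (i : 'I_N) (s : R) (S : set T) :
  0 <= s -> measurable S ->
  (forall w, (forall j, j != i -> G j + Z j w < G i + Z i w) ->
    S w \/ (forall j, j != i -> G j + Z j w <= G i + Z i w - s)) ->
  (bregman_smoothPhi Z (add_est G i (- s)) G <= (s * fine (P S))%:E)%E.
Proof.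
move=> s0 mS hS.
pose A := [set w | forall j, j != i -> G j + Z j w < G i + Z i w].
have mA : measurable A by exact: measurable_argmax.
set x := add_est G i (- s).
have xE j : x j = G j + (if j == i then - s else 0) by [].
(* Outside [A] monotonicity suffices, on [A] inside [S] the two corrections cancel, and on [A]
   outside [S] the maximum really drops by [s]. *)
have pointwise w : maxGZ i x w <=
    maxGZ i G w + (- s) * \1_A w + s * \1_S w.
  have le_max : maxGZ i x w <= maxGZ i G w.
    apply: maxGZ_le => j; rewrite (le_trans _ (maxGZ_ge i G w j))// lerD2r xE.
    by case: ifP; rewrite gerDl ?oppr_le0.
  rewrite !indicE; have [/set_mem Aw|Aw] := boolP (w \in A); last first.
    by rewrite mulr0 addr0 (le_trans le_max)// lerDl mulr_ge0.
  have [Sw|Sw] := boolP (w \in S); first by rewrite !mulr1 subrK.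
  rewrite mulr1 mulr0 addr0.
  case: (hS w Aw) => [/mem_set|hj]; first by rewrite (negbTE Sw).
  apply: maxGZ_le => j; rewrite xE.
  apply: (@le_trans _ _ (G i + Z i w - s)); last by rewrite lerD2r.
  have [->|ji] := eqVneq j i; first by rewrite addrAC.
  by rewrite addr0; exact: hj.
have iA := integrable_indic P mA.
have iS := integrable_indic P mS.
have finP B : measurable B -> P B = (fine (P B))%:E.
  by move=> mB; rewrite fineK// fin_num_measure.
have int_le : (\int[P]_w (maxGZ i x w)%:E <=
    \int[P]_w (maxGZ i G w)%:E + (- s * fine (P A))%:E + (s * fine (P S))%:E)%E.
  have i1 := @integrableZl _ _ _ P _ measurableT (- s) _ iA.
  have i2 := @integrableZl _ _ _ P _ measurableT s _ iS.
  have i0 := integrable_maxGZ i G.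
  apply: le_trans (@le_integral _ _ _ P _ measurableT _ (fun w =>
    ((maxGZ i G w)%:E + (- s)%:E * (\1_A w)%:E + s%:E * (\1_S w)%:E)%E) _ _ _) _.
  - exact: integrable_maxGZ.
  - by apply: integrableD => //; exact: integrableD.
  - by move=> w _; rewrite -!EFinM -!EFinD lee_fin.
  - rewrite integralD//; last exact: integrableD.
    rewrite integralD// !integralZl// !integral_indic// !setIT.
    by rewrite !EFinM -(finP A)// -(finP S).
(* Only coordinate [i] moves, so the linear term is [- s] times the probability of [A]; it cancels
   the first-order term of [int_le]. *)
have -> : bregman_smoothPhi Z x G = (\int[P]_w (maxGZ i x w)%:E -
    \int[P]_w (maxGZ i G w)%:E - (- s * fine (P A))%:E)%E.
  rewrite /bregman_smoothPhi !(smoothPhiE i); congr (_ - _%:E)%E.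
  rewrite (bigD1 i)//= big1 => [|j ji].
    by rewrite addr0 xE eqxx [G i + _]addrC addrK mulrC.
  by rewrite xE (negbTE ji) addr0 subrr mulr0.
move: int_le; have := fin_smoothPhi i x; have := fin_smoothPhi i G.
case: (integral _ _ _) => // a _; case: (integral _ _ _) => // b _.
by rewrite -!EFinD !lee_fin => h; lra.
Qed.

End bregman_bound.

(** * One round of the bandit game *)

Section slab_probability.
Context {R : realType} {d : measure_display} {T : measurableType d}.
Variables (P : probability T R) (Y : {RV P >-> R}) (f : R -> R) (alpha C : R).
Hypotheses (densY : has_density Y f) (cdf_lt1 : forall z, dens_cdf f z < 1).
Hypotheses (alpha01 : 0 <= alpha < 1).
Hypotheses (hazardC : forall z, gen_hazard f alpha z <= C).

Let tail v : R := fine (P (Y @^-1` `]v, +oo[)).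

Let mpre B : measurable B -> measurable (Y @^-1` B).
Proof. by move=> mB; rewrite -[_ @^-1` _]setTI; exact: measurable_funP. Qed.

Let tailE v : tail v = 1 - dens_cdf f v.
Proof.
have [_ _ densE] := densY.
rewrite /tail /dens_cdf -densE//.
have -> : Y @^-1` `]v, +oo[ = ~` (Y @^-1` `]-oo, v]).
  by rewrite preimage_setC setCitvl.
rewrite probability_setC; last exact: mpre.
by rewrite fineB// fin_num_measure//; exact: mpre.
Qed.

Lemma hazard_bound_ge0 : 0 <= C.
Proof.
have [_ f0 _] := densY; apply: le_trans (hazardC 0).
by rewrite divr_ge0 ?powR_ge0// mulr_ge0 ?powR_ge0.
Qed.

(** The tail is nonincreasing, so for [z > v] the factor depending on [tail z] is frozen at [v] and
    enters the constant [K]; what remains is a power singularity at 0. *)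
Lemma hazard_slab_le (v s : R) : 0 < s ->
  (P (Y @^-1` `]v, (v + s)%R[) <=
    (2 * (C / (1 - alpha) * s `^ (1 - alpha)) * tail v `^ (1 - alpha))%:E)%E.
Proof.
move=> s0; have [mf f0 densE] := densY; have C0 := hazard_bound_ge0.
have be0 : 0 < 1 - alpha by have [_ a1] := andP alpha01; rewrite subr_gt0.
pose K := C * tail v `^ (1 - alpha).
have K0 : 0 <= K by rewrite mulr_ge0// powR_ge0.
rewrite densE; last exact: measurable_itv.
have -> : 2 * (C / (1 - alpha) * s `^ (1 - alpha)) * tail v `^ (1 - alpha) =
  2 * (K / (1 - alpha) * s `^ (1 - alpha)) by rewrite /K; ring.
apply: integral_itv_oo_le_abs_powR => // z /andP[vz _] z0.
(* Positivity is essential: with a zero denominator the quotient in [gen_hazard] would be 0 and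
   would say nothing about [f z]. *)
have tz : 0 < tail z by rewrite tailE subr_gt0.
have tzv : tail z <= tail v.
  rewrite /tail fine_le ?fin_num_measure//; [exact: mpre|exact: mpre|].
  apply: le_measure; rewrite ?inE; [exact: mpre|exact: mpre|].
  by move=> w /=; rewrite !in_itv/= !andbT; exact: lt_trans.
have := hazardC z; rewrite /gen_hazard -tailE ler_pdivrMr ?powR_gt0// => hz.
rewrite powRN ler_pdivlMr ?powR_gt0 ?normr_gt0// (le_trans hz)// ler_wpM2l//.
by rewrite ge0_ler_powR ?nnegrE ?(ltW be0) ?(ltW tz) ?(le_trans (ltW tz) tzv).
Qed.

End slab_probability.

Section best_rival.
Context {R : realType} {d : measure_display} {T : measurableType d}.
Variables (P : probability T R) (N : nat) (Z : 'I_N -> {RV P >-> R}).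
Variables (G : 'I_N -> R) (i j0 : 'I_N).
Hypothesis j0i : j0 != i.

(** The seed [j0] is itself a rival, so it leaves the maximum unchanged. Subtracting [G i] turns
    strict victory of [i] into the event that this variable lies below [Z i]. *)
Definition best_rival (w : T) : R :=
  \big[Num.max/G j0 + Z j0 w]_(j | j != i) (G j + Z j w) - G i.

Lemma measurable_best_rival : measurable_fun setT best_rival.
Proof.
apply: measurable_funB => //; apply: measurable_bigmaxr => [|j];
  exact: measurable_funD.
Qed.

HB.instance Definition _ :=
  isMeasurableFun.Build _ _ _ _ best_rival measurable_best_rival.

Lemma best_rival_ltP w x : reflect
  (forall j, j != i -> G j + Z j w < G i + x) (best_rival w < x).
Proof.
rewrite /best_rival ltrBlDl; apply: (iffP (bigmax_ltP _ _ _ _)) => [[_ //]|h].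
by split => //; exact: h.
Qed.

Lemma best_rival_leP w x : reflect
  (forall j, j != i -> G j + Z j w <= G i + x) (best_rival w <= x).
Proof.
rewrite /best_rival lerBlDl; apply: (iffP (bigmax_leP _ _ _ _)) => [[_ //]|h].
by split => //; exact: h.
Qed.

(** The event that every rival stays below a level is a box of rays, one per rival, so adding a
    condition on [Z i] still gives a box and mutual independence factors it. *)
Lemma best_rival_independent : mutually_independent Z ->
  forall a B, measurable B ->
    P (best_rival @^-1` `]-oo, a[ `&` Z i @^-1` B) =
    (P (best_rival @^-1` `]-oo, a[) * P (Z i @^-1` B))%E.
Proof.
move=> indep a.
pose rays B j := if j == i then B else `]-oo, G i + a - G j[%classic : set R.
have raysE B : best_rival @^-1` `]-oo, a[ `&` Z i @^-1` B =
    \bigcap_(j in setT) (Z j @^-1` rays B j).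
  apply/seteqP; split => w.
    move=> [/=]; rewrite in_itv/= => /best_rival_ltP h Bw j _ /=.
    rewrite /rays; case: eqVneq => [->//|ji].
    by rewrite /= in_itv/= ltrBrDl h.
  move=> h; split => /=; last by have := h i I; rewrite /rays/= eqxx.
  rewrite in_itv/=; apply/best_rival_ltP => j ji.
  by have := h j I; rewrite /rays/= (negbTE ji)/= in_itv/= ltrBrDl.
have prodE B : measurable B ->
    P (best_rival @^-1` `]-oo, a[ `&` Z i @^-1` B) = (P (Z i @^-1` B) *
      \prod_(j | j != i) P (Z j @^-1` `]-oo, (G i + a - G j)%R[))%E.
  move=> mB; rewrite raysE indep; last first.
    by move=> j; rewrite /rays; case: ifP => // _; exact: measurable_itv.
  rewrite (bigD1 i)//= /rays eqxx; congr (_ * _)%E.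
  by apply: eq_bigr => j /negbTE ->.
move=> B mB; rewrite prodE// muleC; congr (_ * _)%E.
(* Taking the full set for [B] identifies the product over rivals with the probability of the ray
   event. *)
rewrite -[X in P X]setIT -(preimage_setT (Z i)) prodE//.
by rewrite preimage_setT probability_setT mul1e.
Qed.

End best_rival.

Section bandit_round.
Context {R : realType} {d : measure_display} {T : measurableType d}.
Variables (P : probability T R) (N : nat) (Z : 'I_N -> {RV P >-> R}).
Variables (f : R -> R) (alpha C : R).
Hypotheses (indep : mutually_independent Z) (densZ : forall i, has_density (Z i) f).
Hypothesis intZ : forall i, P.-integrable setT (EFin \o Z i).
Hypotheses (cdf_lt1 : forall z, dens_cdf f z < 1) (alpha01 : 0 <= alpha < 1).
Hypothesis hazardC : forall z, gen_hazard f alpha z <= C.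

Lemma bregman_smoothPhi_hazard_le (G : 'I_N -> R) (i : 'I_N) (s : R) :
  0 <= s -> 0 < grad_smoothPhi Z G i ->
  (bregman_smoothPhi Z (add_est G i (- s)) G <=
    (s * (2 * (C / (1 - alpha) * s `^ (1 - alpha)) *
      grad_smoothPhi Z G i `^ (1 - alpha)))%:E)%E.
Proof.
move=> s_ge0 p0; have C0 : 0 <= C := hazard_bound_ge0 _ _ _ _ _ (densZ i) hazardC.
have be01 : 0 < 1 - alpha <= 1.
  by have [a0 a1] := andP alpha01; rewrite subr_gt0 a1 gerBl.
have [be0 _] := andP be01.
have K0 : 0 <= 2 * (C / (1 - alpha) * s `^ (1 - alpha)).
  by rewrite !mulr_ge0 ?powR_ge0// invr_ge0 ltW.
(* If [s = 0] or there is no rival, arm [i] cannot lose its lead, and the empty set serves as [S];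
   otherwise a rival [j0] exists to seed the maximum. *)
have trivial_case : (forall w,
      (forall j, j != i -> G j + Z j w < G i + Z i w) ->
      forall j, j != i -> G j + Z j w <= G i + Z i w - s) ->
    (bregman_smoothPhi Z (add_est G i (- s)) G <=
    (s * (2 * (C / (1 - alpha) * s `^ (1 - alpha)) *
      grad_smoothPhi Z G i `^ (1 - alpha)))%:E)%E.
  move=> lead; apply: le_trans (bregman_smoothPhi_le _ _ _ intZ G i s set0 s_ge0 _ _) _.
  - exact: measurable0.
  - by move=> w Aw; right; exact: lead.
  - by rewrite measure0/= mulr0 lee_fin mulr_ge0// mulr_ge0// powR_ge0.
have [s0|s_gt0] := leP s 0.
  apply: trivial_case => w Aw j ji.
  by rewrite (le_trans (ltW (Aw j ji)))// lerDl oppr_ge0.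
have [/existsP[j0 j0i]|/existsPn noj] := boolP [exists j, j != i]; last first.
  by apply: trivial_case => w _ j ji; have := noj j; rewrite ji.
pose V : {mfun T >-> R} := best_rival P N Z G i j0.
have law := joint_law_product P V (Z i) (best_rival_independent _ _ _ _ _ _ j0i indep).
have VZE : [set w | V w < Z i w] =
    [set w | forall j, j != i -> G j + Z j w < G i + Z i w].
  by apply/seteqP; split => w /= /(best_rival_ltP _ _ _ _ _ _ j0i).
have := product_slab_le P V (Z i) _ (1 - alpha) s law K0 be01.
rewrite VZE -/(grad_smoothPhi Z G i) => slab.
have {}slab := slab (fun v => hazard_slab_le _ _ _ _ _ (densZ i) cdf_lt1
  alpha01 hazardC v s s_gt0) p0.
have mS : measurable [set w | V w < Z i w < V w + s].
  rewrite (_ : mkset _ = [set w | V w < Z i w] `&` [set w | Z i w < V w + s]).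
    by apply: measurableI; apply: measurable_set_ltr => //; exact: measurable_funD.
  by apply/seteqP; split => w /= => [/andP|[-> ->]].
apply: le_trans (bregman_smoothPhi_le _ _ _ intZ G i s
  [set w | V w < Z i w < V w + s] s_ge0 _ _) _.
- exact: mS.
(* A winning [Z i] outside the slab is at least [V + s], so arm [i] still leads weakly after its
   score drops by [s]. *)
- move=> w Aw; have [VZs|/negP VZs] := boolP (V w < Z i w < V w + s); first by left.
  right => j ji; rewrite -addrA; move: j ji; apply/(best_rival_leP _ _ _ _ _ _ j0i).
  rewrite leNgt; apply/negP => lts; apply: VZs; rewrite -ltrBlDr lts andbT.
  exact/(best_rival_ltP _ _ _ _ _ _ j0i).
- by rewrite lee_fin ler_wpM2l// -lee_fin fineK// fin_num_measure.
Qed.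

(** The importance weight makes [s * p = - c], which lies in [[0, 1]]. Weighting by [p] therefore
    leaves only powers of [- c], each at most 1, however small [p] is. *)
Lemma grad_bregman_le (G : 'I_N -> R) (i : 'I_N) (c : R) : -1 <= c <= 0 ->
  ((grad_smoothPhi Z G i)%:E *
    bregman_smoothPhi Z (add_est G i (c / grad_smoothPhi Z G i)) G
    <= (2 * C / (1 - alpha))%:E)%E.
Proof.
move=> /andP[c1 c0].
have C0 : 0 <= C := hazard_bound_ge0 _ _ _ _ _ (densZ i) hazardC.
have be0 : 0 < 1 - alpha by have [_ a1] := andP alpha01; rewrite subr_gt0.
set p := grad_smoothPhi Z G i.
have rhs0 : 0 <= 2 * C / (1 - alpha) by rewrite divr_ge0 ?mulr_ge0// ltW.
have : 0 <= p by exact: fine_ge0.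
(* An arm of probability 0 contributes 0, as [0 * x = 0] in the extended reals for every [x]. *)
rewrite le_eqVlt => /predU1P[<-|p0]; first by rewrite mul0e lee_fin.
have s0 : 0 <= - c / p by rewrite divr_ge0 ?oppr_ge0// ltW.
have -> : c / p = - (- c / p) by rewrite mulNr opprK.
have := bregman_smoothPhi_hazard_le G i _ s0 p0.
move/(@lee_wpmul2l _ p%:E _) => /(_ (ltW p0)) /le_trans; apply.
rewrite -EFinM lee_fin -/p; set s := - c / p in s0 *.
have -> : p * (s * (2 * (C / (1 - alpha) * s `^ (1 - alpha)) * p `^ (1 - alpha))) =
    2 * C / (1 - alpha) * ((s * p) * (s `^ (1 - alpha) * p `^ (1 - alpha))).
  by ring.
rewrite -powRM ?(ltW p0)// /s divfK ?gt_eqF// ler_piMr// mulr_ile1 ?powR_ge0//.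
- by rewrite oppr_ge0.
- by rewrite lerNl.
- apply: (@le_trans _ _ (1 `^ (1 - alpha))); last by rewrite powR1.
  by rewrite ge0_ler_powR ?nnegrE ?(ltW be0) ?oppr_ge0// lerNl.
Qed.

End bandit_round.

(** Once the earlier arms are fixed, [G] is deterministic, so the conditional expectation is the sum
    over the next arm [i] weighted by its probability. Each of the [N] terms is bounded
    separately. *)
Theorem theorem2 (R : realType) (d : measure_display) (T : measurableType d)
  (P : probability T R) (N : nat) (Z : 'I_N -> {RV P >-> R}) (f : R -> R)
  (alpha C : R) (Tn : nat) (g : nat -> 'I_N -> R) :
  (0 < N)%N ->
  mutually_independent Z ->
  (forall i, has_density (Z i) f) ->
  (forall i, P.-integrable setT (EFin \o Z i)) ->
  (forall z, dens_cdf f z < 1) ->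
  0 <= alpha < 1 ->
  (forall z, gen_hazard f alpha z <= C) ->
  (forall t i, (1 <= t <= Tn)%N -> -1 <= g t i <= 0) ->
  forall (t : nat) (arm : nat -> 'I_N), (1 <= t <= Tn)%N ->
    let G := gbpa_Ghat Z g arm t.-1 in
    (\sum_(i < N) (grad_smoothPhi Z G i)%:E *
        bregman_smoothPhi Z (add_est G i (g t i / grad_smoothPhi Z G i)) G
      <= (2 * C / (1 - alpha) * N%:R)%:E)%E.
Proof.
move=> _ indep densZ intZ cdf_lt1 alpha01 hazardC gb t arm tT /=.
set G := gbpa_Ghat _ _ _ _.
have -> : (2 * C / (1 - alpha) * N%:R)%:E =
    (\sum_(i < N) (2 * C / (1 - alpha))%:E)%E.
  by rewrite sumEFin sumr_const card_ord mulr_natr.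
apply: lee_sum => i _; apply: (grad_bregman_le P N Z f) => //; exact: gb.
Qed.
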